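(* Suppose that: 1. $\Gamma$ is a compact and convex subset of $\mathbb R^{d_\gamma}$. 2. $f(x,p(x),\gamma)$ is differentiable and (componentwise) concave in $\gamma$ for all $(x,p)$. Further suppose that, for $P_{0,X}^{(\infty)}$-almost every fixed realization $\{x_i\}_{i\ge1}$ of $\{X_i\}_{i\ge1}$: 3. There exist $\bar N_1\ge1$ and $\xi>0$ such that $\Gamma_{n,I}(p_0)\subseteq\mathrm{int}(\Gamma)$ and $$\sup_{\gamma\in\partial\Gamma}\max_{1\le i\le n}\max_{1\le j\le d_f}f_j(x_i,p_0(x_i),\gamma)\le-\xi$$ for all $n\ge\bar N_1$. 4. There exist $\gamma^\circ\in\Gamma$, $\eta>0$ and $\bar N_2\ge1$ such that $\min_{1\le i\le n}\min_{1\le j\le d_f}f_j(x_i,p_0(x_i),\gamma^\circ)\ge\eta$ for all $n\ge\bar N_2$. 5. The sets $V_{n,\delta_n}$ satisfy, as $n\to\infty$, $$\sup_{(\gamma,p)\in\Gamma\times V_{n,\delta_n}}\max_{1\le i\le n}\|f(x_i,p(x_i),\gamma)-f(x_i,p_0(x_i),\gamma)\|_2=o(1).$$ Then, for $P_{0,X}^{(\infty)}$-almost every fixed realization $\{x_i\}_{i\ge1}$: for every $\varepsilon>0$ there exists $N\ge1$ such that $p\in V_{n,\delta_n}$ and $n\ge N$ imply $\Gamma_{n,I}(p)\cap B(\gamma,\varepsilon)\ne\emptyset$ for all $\gamma\in\Gamma_{n,I}(p_0)$.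
   Context: $\mathcal X\subseteq\mathbb R^{d_x}$; $\Delta^{K-1}$ is the probability simplex in $\mathbb R^K$; $\{X_i\}_{i\ge1}$ is a sequence of $\mathcal X$-valued random vectors with law $P_{0,X}^{(\infty)}$ and $\{x_i\}_{i\ge1}$ a fixed realization. $\mathcal P$ is a space of functions $p:\mathcal X\to\Delta^{K-1}$ (conditional PMFs) and $p_0\in\mathcal P$ is the true one. $f=(f_1,\dots,f_{d_f}):\mathcal X\times\Delta^{K-1}\times\Gamma\to\mathbb R^{d_f}$ is a known function and $\Gamma_{n,I}(p)=\{\gamma\in\Gamma:f(x_i,p(x_i),\gamma)\in\mathbb R_+^{d_f}\ \forall i=1,\dots,n\}$. For (possibly realization-dependent) sets $\mathcal P_n\subseteq\mathcal P$, semimetrics $d_n$ on $\mathcal P$ and $\delta_n\downarrow0$, $V_{n,\delta_n}=\mathcal P_n\cap\{p\in\mathcal P:d_n(p,p_0)<\delta_n\}$. $B(\gamma,\varepsilon)$ is the open Euclidean ball; $\mathrm{int}$ and $\partial$ denote interior and boundary in $\mathbb R^{d_\gamma}$. *)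

(* Defs.v *)
From HB Require Import structures.
From mathcomp Require Export all_boot all_order all_algebra.
From mathcomp Require Export all_classical all_reals all_analysis.

Set Implicit Arguments.
Unset Strict Implicit.
Unset Printing Implicit Defensive.

Import Order.TTheory GRing.Theory Num.Theory.
Import numFieldNormedType.Exports.

Local Open Scope classical_set_scope.
Local Open Scope ring_scope.

(* The library norm on 'rV[R]_n is the sup norm, hence an explicit l2 norm.
   Topological notions (open, compact, interior) do not depend on this choice. *)
Definition enorm (R : realType) (n : nat) (v : 'rV[R]_n) : R :=
  Num.sqrt (\sum_(j < n) v ord0 j ^+ 2).

Definition eball (R : realType) (n : nat) (c : 'rV[R]_n) (r : R) :
  set 'rV[R]_n := [set v | enorm (v - c) < r].

Definition boundary (T : topologicalType) (A : set T) : set T :=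
  closure A `\` interior A.

(* The simplex of R^K, written Delta^(K-1) in the literature. *)
Definition simplex (R : realType) (K : nat) : set 'rV[R]_K :=
  [set q | (forall k, 0 <= q ord0 k) /\ \sum_(k < K) q ord0 k = 1].
Arguments simplex : clear implicits.

(* Differentiability at a of a function that is only meaningful on A: the
   first-order expansion holds as x tends to a inside A.  At interior points
   of A this is ordinary differentiability. *)
Definition differentiable_within (R : realType) (V W : normedModType R)
    (A : set V) (g : V -> W) (a : V) : Prop :=
  exists L : {linear V -> W}, continuous L /\
    forall x, g x = g a + L (x - a) +o_(x \near within A (nbhs a)) (x - a).

Definition concave_function (R : realType) (E : lmodType R) (A : set E)
    (g : E -> R) : Prop :=
  @convex_function R E A (fun x => - g x).

(* Semimetric = pseudometric: d p q = 0 does not force p = q. *)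
Definition semimetric_on (R : realType) (T : Type) (A : set T)
    (d : T -> T -> R) : Prop :=
  [/\ forall p q, A p -> A q -> 0 <= d p q,
      forall p, A p -> d p p = 0,
      forall p q, A p -> A q -> d p q = d q p &
      forall p q r, A p -> A q -> A r -> d p r <= d p q + d q r].

(* The product sigma-algebra on the sequences in cX, generated by the Borel
   conditions on one coordinate; cX carries the trace Borel sigma-algebra. *)
Definition seq_sigma_algebra (R : realType) (dx : nat) (cX : set 'rV[R]_dx) :
  set (set (nat -> cX)) :=
  <<s [set C | exists (i : nat) (B : set 'rV[R]_dx),
         <<s @open 'rV[R]_dx >> B /\ C = [set x | B (\val (x i))]] >>.

Definition random_vector (d : measure_display) (Omega : measurableType d)
    (R : realType) (dx : nat) (cX : set 'rV[R]_dx) (Y : Omega -> cX) : Prop :=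
  measurable_fun [set: Omega]
    ((fun w => \val (Y w)) : Omega -> g_sigma_algebraType (@open 'rV[R]_dx)).

Definition seq_law (d : measure_display) (Omega : measurableType d)
    (R : realType) (Pr : probability Omega R) (dx : nat) (cX : set 'rV[R]_dx)
    (X : nat -> Omega -> cX) (B : set (nat -> cX)) : \bar R :=
  Pr [set w | B (fun i => X i w)].

(* The library's almost-everywhere quantifier, for the law of X on the
   sequence space; it is spelled out because measurable types are pointed in
   the library, while the type of sequences in cX has no canonical point. *)
Definition ae_realization (d : measure_display) (Omega : measurableType d)
    (R : realType) (Pr : probability Omega R) (dx : nat) (cX : set 'rV[R]_dx)
    (X : nat -> Omega -> cX) (Q : (nat -> cX) -> Prop) : Prop :=
  exists B : set (nat -> cX),
    [/\ seq_sigma_algebra B, seq_law Pr X B = 0%E & ~` [set x | Q x] `<=` B].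

(* In what follows a realization (x_1, x_2, ...) is a function on nat whose
   value at i is x_(i+1), so that i < n enumerates x_1, ..., x_n; only the
   values of f x q at points of Gam are meaningful. *)
Definition GammaI (R : realType) (dx K dg df : nat) (cX : set 'rV[R]_dx)
    (Gam : set 'rV[R]_dg)
    (f : cX -> simplex R K -> 'rV[R]_dg -> 'rV[R]_df)
    (x : nat -> cX) (n : nat) (p : cX -> simplex R K) : set 'rV[R]_dg :=
  [set g | Gam g /\
     forall i : 'I_n, forall j : 'I_df, 0 <= f (x i) (p (x i)) g ord0 j].

Definition max_f (R : realType) (dx K dg df : nat) (cX : set 'rV[R]_dx)
    (f : cX -> simplex R K -> 'rV[R]_dg -> 'rV[R]_df)
    (x : nat -> cX) (n : nat) (p : cX -> simplex R K) (g : 'rV[R]_dg) :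
    \bar R :=
  \big[maxe/-oo%E]_(i < n) \big[maxe/-oo%E]_(j < df)
    (f (x i) (p (x i)) g ord0 j)%:E.

Definition min_f (R : realType) (dx K dg df : nat) (cX : set 'rV[R]_dx)
    (f : cX -> simplex R K -> 'rV[R]_dg -> 'rV[R]_df)
    (x : nat -> cX) (n : nat) (p : cX -> simplex R K) (g : 'rV[R]_dg) :
    \bar R :=
  \big[mine/+oo%E]_(i < n) \big[mine/+oo%E]_(j < df)
    (f (x i) (p (x i)) g ord0 j)%:E.

Definition nbhd_V (R : realType) (T : Type) (cP Pn : set T)
    (dn : T -> T -> R) (p0 : T) (delta : R) : set T :=
  Pn `&` [set p | cP p /\ dn p p0 < delta].

(* The supremum is taken in [0, +oo], so that it is 0 when V is empty. *)
Definition sup_deviation (R : realType) (dx K dg df : nat)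
    (cX : set 'rV[R]_dx) (Gam : set 'rV[R]_dg)
    (f : cX -> simplex R K -> 'rV[R]_dg -> 'rV[R]_df)
    (x : nat -> cX) (n : nat) (p0 : cX -> simplex R K)
    (V : set (cX -> simplex R K)) : \bar R :=
  maxe 0%E (ereal_sup
    [set \big[maxe/-oo%E]_(i < n)
           (enorm (f (x i) (gp.2 (x i)) gp.1 - f (x i) (p0 (x i)) gp.1))%:E
    | gp in Gam `*` V]).

(* Main.v *)
(* Move a point g of Gamma_{n,I}(p0) towards the Slater point g0: by concavity
   the constraints at g_t = t g0 + (1 - t) g hold under p0 with slack t * eta,
   uniformly in g and n.  A deviation below t * eta cannot destroy them, and the
   boundedness of Gamma makes |g_t - g| = t |g0 - g| < eps for t small. *)
Require Import Defs.
From mathcomp Require Import all_boot all_order all_algebra.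
From mathcomp Require Import all_classical all_reals all_analysis.
From mathcomp Require Import lra.

Import Order.TTheory GRing.Theory Num.Theory.
Import numFieldNormedType.Exports.

Local Open Scope classical_set_scope.
Local Open Scope ring_scope.

Lemma enormZ (R : realType) (n : nat) (a : R) (v : 'rV[R]_n) :
  enorm (a *: v) = `|a| * enorm v.
Proof.
rewrite /enorm -sqrtr_sqr -sqrtrM ?sqr_ge0// mulr_sumr; congr Num.sqrt.
by apply: eq_bigr => j _; rewrite mxE exprMn.
Qed.

Lemma ler_coord_enorm (R : realType) (n : nat) (v : 'rV[R]_n) (j : 'I_n) :
  `|v ord0 j| <= enorm v.
Proof.
rewrite -sqrtr_sqr ler_wsqrtr// (bigD1 j)//= lerDl.
by apply: sumr_ge0 => k _; exact: sqr_ge0.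
Qed.

(** Each of the [n] squares is at most the square of the sup norm. This carries bounds from the
    library norm, in which compactness bounds [Gam], over to the l2 norm of [eball]. *)
Lemma enorm_le_norm (R : realType) (n : nat) (v : 'rV[R]_n) :
  enorm v <= Num.sqrt n%:R * `|v|.
Proof.
rewrite -[`|v|]ger0_norm// -sqrtr_sqr -sqrtrM ?ler0n// ler_wsqrtr//.
suff: \sum_(j < n) v ord0 j ^+ 2 <= \sum_(j < n) `|v| ^+ 2.
  by rewrite mulr_natl sumr_const card_ord.
apply: ler_sum => j _.
rewrite -real_normK ?num_real// lerXn2r ?nnegrE//.
rewrite [leRHS]mx_normrE.
exact: (le_bigmax 0 (fun ij : 'I_1 * 'I_n => `|v ij.1 ij.2|) (ord0, j)).
Qed.

(** The slack [t * eta] gained from [g0] pays for the deviation: passing from [p0] to [p] lowers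
    each coordinate of [f] by at most the l2 norm of the difference. *)
Lemma GammaI_conv (R : realType) (dx K dg df : nat) (cX : set 'rV[R]_dx)
    (Gam : set 'rV[R]_dg) (f : cX -> simplex R K -> 'rV[R]_dg -> 'rV[R]_df)
    (x : nat -> cX) (n : nat) (p0 p : cX -> simplex R K)
    (g0 g : 'rV[R]_dg) (eta : R) (t : {i01 R}) :
  @convex_set R 'rV[R]_dg Gam ->
  (forall (i : 'I_n) (j : 'I_df),
     concave_function Gam (fun g => f (x i) (p0 (x i)) g ord0 j)) ->
  Gam g0 ->
  (forall (i : 'I_n) (j : 'I_df), eta <= f (x i) (p0 (x i)) g0 ord0 j) ->
  (forall g', Gam g' -> forall i : 'I_n,
     enorm (f (x i) (p (x i)) g' - f (x i) (p0 (x i)) g') <= t%:num * eta) ->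
  GammaI Gam f x n p0 g ->
  GammaI Gam f x n p (t%:num *: g0 + (1 - t%:num) *: g).
Proof.
move=> Gam_convex f_concave Gg0 slater dev [Gg fg].
have Gt : Gam (t%:num *: g0 + (1 - t%:num) *: g).
  exact/set_mem/(Gam_convex g0 g t (mem_set Gg0) (mem_set Gg)).
split=> // i j; set gt := (X in f _ _ X).
have conc : t%:num * eta <= f (x i) (p0 (x i)) gt ord0 j.
  (* Concavity is convexity of the opposite, so signs are flipped back; the term weighted by [1 - t]
     is nonnegative because [g] is feasible under [p0], and is dropped. *)
  have := f_concave i j t g0 g (mem_set Gg0) (mem_set Gg).
  rewrite /= -convN lerN2 convRE; apply: le_trans.
  by rewrite -[leLHS]addr0 lerD ?mulr_ge0 ?ler_wpM2l// subr_ge0 le1.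
have := le_trans (@ler_coord_enorm _ _ _ j) (dev _ Gt i).
rewrite !mxE ler_norml => /andP[+ _]; lra.
Qed.

Lemma le_min_f (R : realType) (dx K dg df : nat) (cX : set 'rV[R]_dx)
    (f : cX -> simplex R K -> 'rV[R]_dg -> 'rV[R]_df) (x : nat -> cX)
    (n : nat) (p : cX -> simplex R K) (g : 'rV[R]_dg) (c : R) :
  (c%:E <= min_f f x n p g)%E ->
  forall (i : 'I_n) (j : 'I_df), c <= f (x i) (p (x i)) g ord0 j.
Proof.
move=> cf i j; rewrite -lee_fin; apply: (le_trans cf).
by apply: (le_trans (bigmin_le _ i _)); exact: bigmin_le.
Qed.

Lemma enorm_le_sup_deviation (R : realType) (dx K dg df : nat)
    (cX : set 'rV[R]_dx) (Gam : set 'rV[R]_dg)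
    (f : cX -> simplex R K -> 'rV[R]_dg -> 'rV[R]_df) (x : nat -> cX)
    (n : nat) (p0 p : cX -> simplex R K) (V : set (cX -> simplex R K))
    (g : 'rV[R]_dg) (i : 'I_n) :
  V p -> Gam g ->
  ((enorm (f (x i) (p (x i)) g - f (x i) (p0 (x i)) g))%:E
     <= sup_deviation Gam f x n p0 V)%E.
Proof.
move=> Vp Gg; rewrite /sup_deviation le_max; apply/orP; right.
apply: le_trans; last by apply: ereal_sup_ubound; exists (g, p).
exact: (le_bigmax _ (fun i : 'I_n =>
  (enorm (f (x i) (p (x i)) g - f (x i) (p0 (x i)) g))%:E) i).
Qed.

Lemma near_cvge0_lt (R : realType) (u : nat -> \bar R) (c : R) :
  u n @[n --> \oo] --> 0%E -> 0 < c -> \forall n \near \oo, (u n < c%:E)%E.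
Proof.
move=> u0 c0; apply: (u0 [set y | (y < c%:E)%E]).
(* Neighbourhoods of the finite point [0%E] in the extended reals unfold to neighbourhoods of 0 in
   [R]. *)
suff : \forall r \near (0 : R), (r%:E < c%:E)%E by [].
by apply: filterS (lt_nbhsl c0) => r; rewrite lte_fin.
Qed.

Theorem proposition4 (R : realType) (dx K dg df : nat)
  (cX : set 'rV[R]_dx)
  (d : measure_display) (Omega : measurableType d) (Pr : probability Omega R)
  (X : nat -> Omega -> cX) (X_random : forall i, random_vector (X i))
  (cP : set (cX -> simplex R K)) (p0 : cX -> simplex R K) (cP_p0 : cP p0)
  (Gam : set 'rV[R]_dg)
  (f : cX -> simplex R K -> 'rV[R]_dg -> 'rV[R]_df)
  (Pn : (nat -> cX) -> nat -> set (cX -> simplex R K))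
  (Pn_sub : forall x n, Pn x n `<=` cP)
  (dn : (nat -> cX) -> nat -> (cX -> simplex R K) -> (cX -> simplex R K) -> R)
  (dn_semimetric : forall x n, semimetric_on cP (dn x n))
  (delta : nat -> R)
  (delta_decr : {homo delta : m n / (m <= n)%N >-> n <= m})
  (delta_cvg0 : delta n @[n --> \oo] --> (0 : R))
  (Gam_compact : compact Gam)
  (Gam_convex : @convex_set R 'rV[R]_dg Gam)
  (f_diff : forall (x : cX) (p : cX -> simplex R K), cP p ->
     forall g, Gam g -> differentiable_within Gam (f x (p x)) g)
  (f_concave : forall (x : cX) (p : cX -> simplex R K), cP p ->
     forall j : 'I_df,
       concave_function Gam (fun g : 'rV[R]_dg => f x (p x) g ord0 j))
  (ae_hyps : ae_realization Pr X (fun x : nat -> cX =>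
     [/\ exists (N1 : nat) (xi : R),
           [/\ (1 <= N1)%N, 0 < xi &
             forall n, (N1 <= n)%N ->
               GammaI Gam f x n p0 `<=` interior Gam /\
               (ereal_sup [set max_f f x n p0 g | g in boundary Gam]
                  <= (- xi)%:E)%E],
         exists (g0 : 'rV[R]_dg) (eta : R) (N2 : nat),
           [/\ Gam g0, 0 < eta, (1 <= N2)%N &
             forall n, (N2 <= n)%N -> (eta%:E <= min_f f x n p0 g0)%E] &
         sup_deviation Gam f x n p0
           (nbhd_V cP (Pn x n) (dn x n) p0 (delta n))
           @[n --> \oo] --> 0%E])) :
  ae_realization Pr X (fun x : nat -> cX =>
    forall eps : R, 0 < eps ->
      exists N : nat, (1 <= N)%N /\
        forall (n : nat) (p : cX -> simplex R K),
          nbhd_V cP (Pn x n) (dn x n) p0 (delta n) p -> (N <= n)%N ->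
          forall g, GammaI Gam f x n p0 g ->
            GammaI Gam f x n p `&` eball g eps !=set0).
Proof.
(* The same null set [B] serves: it suffices to derive the conclusion for each realization
   satisfying the hypotheses. *)
have [B [mB B0 QB]] := ae_hyps; exists B; split=> //; apply: subset_trans QB.
apply: subsetC => x /= [_ [g0 [eta [N2 [Gg0 eta0 _ slater]]]] dev] eps eps0.
have [M M0 GM] := ex_strict_bound_gt0 (compact_bounded Gam_compact).
(* [C] bounds the l2 diameter of [Gam], since two of its points differ by at most [M + M] in sup
   norm. The added 1 makes the bound strict and keeps [C] positive even when [dg] is 0. *)
pose C := Num.sqrt dg%:R * (M + M) + 1.
have C0 : 0 < C by rewrite ltr_wpDl// mulr_ge0 ?sqrtr_ge0// addr_ge0// ltW.
(* The cap at 1 makes [t] a convex weight, and [eps / C] gives [t * C <= eps]. Since [t] is chosen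
   before [n], [p] and [g], the resulting threshold is uniform in them. *)
pose t := Num.min 1 (eps / C).
have t0 : 0 < t by rewrite lt_min ltr01 divr_gt0.
have t1 : t <= 1 by rewrite ge_min lexx.
have [N3 _ small] := @near_cvge0_lt _ _ _ dev (mulr_gt0 t0 eta0).
(* Beyond [N2] the Slater bound holds at [g0]; beyond [N3] the deviation is below [t * eta]. *)
exists (maxn 1 (maxn N2 N3)); split; first exact: leq_maxl.
move=> n p Vp; rewrite !geq_max => /and3P[_ N2n N3n] g Ig.
exists (t *: g0 + (1 - t) *: g); split.
  apply: (@GammaI_conv _ _ _ _ _ _ _ _ _ _ _ _ _ _ eta
    (Itv01 (ltW t0) t1) Gam_convex _ Gg0 _ _ Ig) => [i j|i j|g' Gg' i].
  - exact: f_concave.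
  - exact: (@le_min_f _ _ _ _ _ _ _ _ _ _ _ _ (slater n N2n)).
  - rewrite -lee_fin; apply: le_trans (ltW (small n N3n)).
    exact: enorm_le_sup_deviation.
rewrite /eball /=.
have -> : t *: g0 + (1 - t) *: g - g = t *: (g0 - g).
  by rewrite scalerBl scale1r addrCA addrAC subrr add0r scalerBr addrC.
rewrite enormZ (gtr0_norm t0).
have dist : enorm (g0 - g) < C.
  apply: le_lt_trans (@enorm_le_norm _ _ _) _.
  rewrite ltr_pwDr// ler_wpM2l ?sqrtr_ge0//.
  by rewrite (le_trans (ler_normB _ _))// lerD// ltW//; apply: GM => //; case: Ig.
have tC : t * C <= eps by rewrite -ler_pdivlMr// ge_min lexx orbT.
by apply: lt_le_trans tC; rewrite ltr_pM2l.
Qed.
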